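(* Let $n, l$ be positive integers and $p$ a prime. Write $n = q p^k$ with $k \geq 0$ an integer and $q$ a positive integer with $p \nmid q$. Define $$\alpha(n,p) = 1 + k + \delta_{p,2}(1-\delta_{k,0}),$$ where $\delta_{ij}$ is the Kronecker delta (so $\alpha = 1+k$ unless $p=2$ and $k>0$, in which case $\alpha = 2+k$). Let $X_{l,p} = \{x' \in \mathbb{Z} : 0 \leq x' < p^l\}$. Then for each integer $r$ with $0 < r < p$, the map $C_r : X_{l,p} \to X_{l,p}$ defined by $$C_r(x') = \left\lfloor \frac{(p x' + r)^n}{p^{\alpha(n,p)}} \right\rfloor \bmod p^l$$ is a bijection (a permutation of $X_{l,p}$).
   Context: $\lfloor y \rfloor$ denotes the largest integer $\leq y$, and $a \bmod m$ denotes the least non-negative residue of $a$ modulo $m$. *)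

(* Defs.v *)
From mathcomp Require Import all_boot.

Set Implicit Arguments.
Unset Strict Implicit.
Unset Printing Implicit Defensive.

Definition kronecker (i j : nat) : nat := i == j.

(* alpha(n, p) depends on n only through the exponent k in n = q * p ^ k with *)
(* p not dividing q.                                                          *)
Definition alpha (p k : nat) : nat :=
  1 + k + kronecker p 2 * (1 - kronecker k 0).

Lemma ord_bound_gt0 (N : nat) (x : 'I_N) : 0 < N.
Proof. exact: leq_ltn_trans (leq0n x) (ltn_ord x). Qed.

(* %/ is the floor of the quotient, both operands being natural numbers. *)
Definition C (n l p k r : nat) (x : 'I_(p ^ l)) : 'I_(p ^ l) :=
  Ordinal (ltn_pmod ((p * x + r) ^ n %/ p ^ alpha p k) (ord_bound_gt0 x)).

(* Main.v *)
Require Import Defs.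
From mathcomp Require Import all_boot.
From mathcomp Require Import zify.

(** Since [X_{l,p}] is finite, injectivity suffices. For [y < x] put
    [a = p x + r] and [b = p y + r]. Lifting the exponent gives
    [v_p(a^n - b^n) = v_p(a - b) + k] when [p] is odd or [k = 0], and
    [v_2(a^n - b^n) = v_2(a - b) + v_2(a + b) + k - 1] when [p = 2] and [k > 0].
    In both cases this valuation lies in [[alpha, l + alpha)], the upper bound
    because [0 < x - y < p^l] (and [x + y + 1 < 2^(l+1)] when [p = 2]). Hence
    [a^n] and [b^n] agree modulo [p^alpha] but not modulo [p^(l + alpha)], so
    their quotients by [p^alpha] differ modulo [p^l]. *)

Lemma eqn_mod_mul_of_div (m N a b : nat) :
  a = b %[mod m] -> a %/ m = b %/ m %[mod N] -> a = b %[mod N * m].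
Proof.
move=> eq_mod eq_div; rewrite (divn_eq a m) (divn_eq b m) eq_mod.
have [->|m_gt0] := posnP m; first by rewrite !muln0.
by apply/eqP; rewrite eqn_modDr -!muln_modl eq_div.
Qed.

Lemma logn_lt_exp (p m l : nat) : prime p -> 0 < m < p ^ l -> logn p m < l.
Proof.
move=> p_pr /andP[m_gt0 m_lt]; rewrite ltnNge -pfactor_dvdn //.
by apply/negP => /(dvdn_leq m_gt0); rewrite leqNgt m_lt.
Qed.

(** In [a ^ q - b ^ q = (a - b) * S], each of the [q] terms of [S] is congruent to [b ^ q.-1] modulo
    [p], so [S] is congruent to [q * b ^ q.-1] and is prime to [p]. *)
Lemma logn_sub_exp_coprime (p a b q : nat) :
  prime p -> ~~ (p %| b) -> ~~ (p %| q) -> b < a -> p %| a - b ->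
  logn p (a ^ q - b ^ q) = logn p (a - b).
Proof.
move=> p_pr pNb pNq b_lt_a p_ab.
have a_b : a = b %[mod p] by apply/eqP; rewrite eqn_mod_dvd // ltnW.
rewrite subn_exp; set S := \sum_(i < q) _.
have S_mod : S = q * b ^ q.-1 %[mod p].
  have -> : q * b ^ q.-1 = \sum_(i < q) b ^ q.-1 by rewrite sum_nat_const card_ord.
  apply: (big_rec2 (fun s t => s = t %[mod p])) => // i s t _ s_t.
  rewrite -modnDm s_t -modnMml -modnXm a_b modnXm modnMml -expnD modnDm subnK //.
  by rewrite -ltnS (ltn_predK (ltn_ord i)) ltn_ord.
have pNS : ~~ (p %| S).
  rewrite /dvdn S_mod -/(dvdn p _) Euclid_dvdM // Euclid_dvdX // negb_or pNq.
  by rewrite (negPf pNb).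
have S_gt0 : 0 < S by case: S pNS {S_mod} => //; rewrite dvdn0.
rewrite lognM ?subn_gt0 // (logn_coprime (_ : coprime p S)) ?addn0 //.
by rewrite prime_coprime.
Qed.

(** Every binomial term beyond the linear one is a multiple of [d * p * p]. For [2 <= i < p], the
    coefficient supplies one [p] and [d ^ 2] supplies [d * p]. The last term [d ^ p] is a multiple
    of [d ^ 3] for odd [p]; for [p = 2] it is only [d ^ 2], hence the condition [4 %| d]. *)
Lemma expD_prime_expansion (p b d : nat) :
  prime p -> p %| d -> (p = 2 -> 4 %| d) ->
  exists e, (b + d) ^ p = b ^ p + d * p * (b ^ p.-1 + p * e).
Proof.
move=> p_pr p_d d4; have p_gt1 := prime_gt1 p_pr.
have [e0 e0E] : exists e, \sum_(2 <= i < p) 'C(p, i) * (b ^ (p - i) * d ^ i)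
    = d * p * (p * e).
  suff /dvdnP[e ->] : d * p * p %| \sum_(2 <= i < p) 'C(p, i) * (b ^ (p - i) * d ^ i).
    by exists e; lia.
  rewrite big_nat; apply: dvdn_sum => i /andP[i_ge2 i_lt].
  rewrite [d * p * p]mulnC; apply: dvdn_mul.
    by apply: prime_dvd_bin => //; lia.
  apply: dvdn_mull; apply: dvdn_trans (dvdn_exp2l d i_ge2).
  by rewrite -mulnn dvdn_mul.
have [e1 e1E] : exists e, d ^ p = d * p * (p * e).
  suff /dvdnP[e ->] : d * p * p %| d ^ p by exists e; lia.
  have [p2|p_neq2] := eqVneq p 2.
    by rewrite [in d ^ _]p2 -mulnn -mulnA dvdn_mul // p2 d4.
  apply: (@dvdn_trans (d ^ 3)); first by rewrite !expnS expn0 muln1 mulnA !dvdn_mul.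
  by apply: dvdn_exp2l; lia.
exists (e0 + e1).
rewrite expnDn -(big_mkord xpredT (fun i => 'C(p, i) * (b ^ (p - i) * d ^ i))).
rewrite big_ltn // big_ltn ?big_nat_recr //=; last by lia.
rewrite e0E bin0 bin1 binn subnn subn0 subn1 expn0 expn1 e1E; lia.
Qed.

(** The difference is [d * p] times a factor congruent to [b ^ p.-1] modulo [p], hence prime to
    [p]. *)
Lemma logn_sub_exp_prime (p b d : nat) :
  prime p -> ~~ (p %| b) -> 0 < d -> p %| d -> (p = 2 -> 4 %| d) ->
  logn p ((b + d) ^ p - b ^ p) = (logn p d).+1.
Proof.
move=> p_pr pNb d_gt0 p_d d4; have p_gt0 := prime_gt0 p_pr.
have [e ->] := expD_prime_expansion p b d p_pr p_d d4.
rewrite addKn; set f := b ^ p.-1 + p * e.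
have pNf : ~~ (p %| f).
  rewrite dvdn_addl ?dvdn_mulr //.
  by apply: contra pNb; rewrite Euclid_dvdX // => /andP[].
have f_gt0 : 0 < f by case: f pNf => //; rewrite dvdn0.
rewrite !lognM ?muln_gt0 ?d_gt0 // (logn_prime _ p_pr) eqxx addn1.
by rewrite (logn_coprime (_ : coprime p f)) ?addn0 // prime_coprime.
Qed.

(** Each [p]-th power adds one to the valuation. The divisibility conditions persist because [a - b]
    divides every later difference. *)
Lemma logn_sub_exp_prime_power (p a b k : nat) :
  prime p -> ~~ (p %| b) -> b < a -> p %| a - b -> (p = 2 -> 4 %| a - b) ->
  logn p (a ^ (p ^ k) - b ^ (p ^ k)) = logn p (a - b) + k.
Proof.
move=> p_pr pNb b_lt_a p_ab ab4; have p_gt0 := prime_gt0 p_pr.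
elim: k => [|k IHk]; first by rewrite expn0 !expn1 addn0.
have pk_gt0 : 0 < p ^ k by rewrite expn_gt0 p_gt0.
have sub_dvd : a - b %| a ^ (p ^ k) - b ^ (p ^ k) by rewrite subn_exp dvdn_mulr.
rewrite expnSr !expnM; set A := a ^ _; set B := b ^ _.
have B_lt_A : B < A by rewrite ltn_exp2r.
rewrite -[in A ^ p](subnKC (ltnW B_lt_A)) logn_sub_exp_prime ?subn_gt0 //.
- by rewrite IHk addnS.
- by rewrite Euclid_dvdX // (negPf pNb).
- exact: dvdn_trans sub_dvd.
- by move=> /ab4 ab4'; apply: dvdn_trans sub_dvd.
Qed.

Lemma logn_sub_exp_mul_add_bounds (p q k l r x y : nat) :
  prime p -> ~~ (p %| q) -> 0 < r < p -> y < x < p ^ l ->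
  alpha p k
    <= logn p ((p * x + r) ^ (q * p ^ k) - (p * y + r) ^ (q * p ^ k))
    < l + alpha p k.
Proof.
move=> p_pr pNq /andP[r_gt0 r_lt_p] /andP[y_lt_x x_lt]; have p_gt0 := prime_gt0 p_pr.
set a := p * x + r; set b := p * y + r.
have b_lt_a : b < a by rewrite ltn_add2r ltn_pmul2l.
have abE : a - b = p * (x - y) by rewrite subnDr mulnBr.
have p_ab : p %| a - b by rewrite abE dvdn_mulr.
have pNb : ~~ (p %| b).
  by rewrite dvdn_addr ?dvdn_mulr //; apply/negP => /(dvdn_leq r_gt0); lia.
have log_ab : logn p (a - b) = (logn p (x - y)).+1.
  by rewrite abE lognM ?subn_gt0 // (logn_prime _ p_pr) eqxx.
have log_xy : logn p (x - y) < l by apply: logn_lt_exp => //; lia.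
have pk_gt0 : 0 < p ^ k by rewrite expn_gt0 p_gt0.
(* The exponent [q] is applied last, to [a ^ (p ^ k)] and [b ^ (p ^ k)], and leaves the valuation
   unchanged. *)
rewrite mulnC !expnM logn_sub_exp_coprime //; first last.
- by apply: dvdn_trans p_ab _; rewrite subn_exp dvdn_mulr.
- by rewrite ltn_exp2r.
- by rewrite Euclid_dvdX // (negPf pNb).
have [->|k_gt0] := posnP k.
  by rewrite expn0 !expn1 log_ab /alpha /kronecker eqxx /=; lia.
rewrite /alpha /kronecker eqn0Ngt k_gt0 /= subn0 muln1.
have [p2|p_neq2] := eqVneq p 2; last first.
  rewrite logn_sub_exp_prime_power // ?log_ab; last by move/eqP: p_neq2.
  lia.
(* Lifting the exponent at 2 needs [4 %| a - b], so start from [a^2 - b^2]. *)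
have sumE : a + b = p * (x + y + 1) by rewrite /a /b p2; lia.
have log_sum : logn p (a + b) = (logn p (x + y + 1)).+1.
  by rewrite sumE lognM // ?addn1 // (logn_prime _ p_pr) eqxx.
have log_xy1 : logn p (x + y + 1) < l.+1.
  by apply: logn_lt_exp => //; rewrite expnS {1}p2; lia.
have log_sq : logn p (a ^ p - b ^ p)
    = (logn p (x - y) + logn p (x + y + 1)).+2.
  rewrite [in a ^ _]p2 [in b ^ _]p2 subn_sqr lognM ?subn_gt0 //; last by lia.
  by rewrite log_ab log_sum; lia.
(* [x - y] and [x + y + 1] have opposite parity, so exactly one of the two valuations vanishes.
   Their sum is therefore positive and equal to the other one, hence at most [l]. *)
have one_even : 0 < logn p (x - y) + logn p (x + y + 1).
  rewrite addn_gt0 !logn_gt0 !mem_primes p_pr subn_gt0 y_lt_x addn1 /= p2 !dvdn2 /=.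
  by rewrite oddB 1?ltnW // oddD; case: (odd x) (odd y) => [] [].
have one_odd : (logn p (x - y) == 0) || (logn p (x + y + 1) == 0).
  rewrite !eqn0Ngt !logn_gt0 !mem_primes p_pr subn_gt0 y_lt_x addn1 /= p2 !dvdn2 /=.
  by rewrite oddB 1?ltnW // oddD; case: (odd x) (odd y) => [] [].
have log_sq_bounds : 2 < logn p (a ^ p - b ^ p) < l + 3 by rewrite log_sq; lia.
(* One squaring is split off [2 ^ k]; the remaining ones act on [a ^ 2] and [b ^ 2], whose
   difference is divisible by 8. *)
case: k k_gt0 pk_gt0 => // k _ _; rewrite expnS !expnM.
have sq_lt : b ^ p < a ^ p by rewrite ltn_exp2r.
have sq_dvd e : e <= 3 -> p ^ e %| a ^ p - b ^ p.
  by move=> e_le3; rewrite pfactor_dvdn ?subn_gt0 //; lia.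
rewrite logn_sub_exp_prime_power //.
- by lia.
- by rewrite Euclid_dvdX // (negPf pNb).
- exact: (sq_dvd 1).
- by move=> _; have := sq_dvd 2 isT; rewrite {1}p2.
Qed.

Theorem theorem1 (n l p q k : nat)
  (n_gt0 : 0 < n) (l_gt0 : 0 < l) (p_prime : prime p)
  (q_gt0 : 0 < q) (p_ndvd_q : ~~ (p %| q)) (n_eq : n = q * p ^ k) :
  forall r : nat, 0 < r < p -> bijective (@C n l p k r).
Proof.
move=> r r_bounds; apply: injF_bij => x y.
have p_gt0 := prime_gt0 p_prime.
wlog y_lt_x : x y / y < x.
  move=> wlog_lt Cxy; apply: val_inj.
  by case: (ltngtP x y) => // lt_xy; [rewrite (wlog_lt y x)|rewrite (wlog_lt x y)].
move=> /(congr1 val) /= Cxy.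
have xy_bounds : y < x < p ^ l by rewrite y_lt_x ltn_ord.
have := @logn_sub_exp_mul_add_bounds p q k l r x y p_prime p_ndvd_q r_bounds xy_bounds.
rewrite -n_eq; set a := p * x + r in Cxy *; set b := p * y + r in Cxy *.
have ab_exp : b ^ n < a ^ n by rewrite ltn_exp2r // ltn_add2r ltn_pmul2l.
have ab_exp_le := ltnW ab_exp.
(* The lower bound becomes a congruence modulo [p ^ alpha p k]. Together with [Cxy] it yields one
   modulo [p ^ (l + alpha p k)], which the upper bound forbids. *)
case/andP; rewrite -pfactor_dvdn ?subn_gt0 // -eqn_mod_dvd // => /eqP ab_mod.
rewrite ltnNge -pfactor_dvdn ?subn_gt0 // -eqn_mod_dvd //.
by rewrite expnD (eqn_mod_mul_of_div _ _ _ _ ab_mod Cxy) eqxx.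
Qed.
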